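(* Let $d\geq1$ and let the complex sequence $\{a_k\}_{k=0}^\infty$ satisfy a fixed recurrence relation of Poincaré type $$a_k=\sum_{j=1}^d[c_j+\psi_j(k)]\,a_{k-j},\qquad k=d,d+1,\dots,\qquad \lim_{k\to\infty}\psi_j(k)=0\quad(j=1,\dots,d),$$ with $c_j,\psi_j(k)\in\mathbb{C}$. Let $\sigma_1,\dots,\sigma_d$ be the roots of $\sigma^d-\sum_{j=1}^dc_j\sigma^{d-j}=0$, put $\rho=\max_j|\sigma_j|$, assume $\rho>0$, and put $R=2^{-(d+3)}\rho^{-1}$. Let $\hat N$ be the minimal of the natural numbers $n$ such that for all $k>n$ (with $k\geq d$) we have $|\psi_j(k)|\leq2^d\rho^j$, $j=1,\dots,d$. Put $N=\hat N+d$ and $C=2^{(d+3)N}$. Then $\{a_k\}_{k=0}^\infty$ possesses the $(N,R,C)$-Taylor domination property.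
   Context: Taylor domination: for a finite $R>0$, an integer $N\geq0$ and a constant $C>0$, the sequence $\{a_k\}$ (equivalently, the series $\sum_{k\geq0}a_kz^k$) possesses the $(N,R,C)$-Taylor domination property if $|a_k|R^k\leq C\max_{i=0,\dots,N}|a_i|R^i$ for each $k\geq N+1$. Natural numbers include $0$. *)

(* Defs.v *)
(* The complex numbers are K[i] for K : realType. *)
From mathcomp Require Export all_boot all_order all_algebra.
From mathcomp Require Export complex.
From mathcomp Require Export all_classical all_reals all_analysis.
Export Order.TTheory GRing.Theory Num.Theory numFieldNormedType.Exports.

Set Implicit Arguments.
Unset Strict Implicit.
Unset Printing Implicit Defensive.

Local Open Scope complex_scope.
Local Open Scope classical_set_scope.
Local Open Scope ring_scope.

(* The modulus with values in the ordered field K; the generic norm `|z| on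
   K[i] is its image (cmod z)%:C in K[i]. *)
Definition cmod (K : realType) (z : K[i]) : K := Normc.normc z.

(* The base value 0 of the maximum is harmless: all terms are nonnegative and
   the index range is nonempty. *)
Definition taylor_domination (K : realType) (N : nat) (R C : K)
    (a : nat -> K[i]) : Prop :=
  forall k : nat, (N + 1 <= k)%N ->
    cmod (a k) * R ^+ k <= C * \big[Num.max/0]_(0 <= i < N.+1) (cmod (a i) * R ^+ i).

(* The values c j and psi j k matter only for 1 <= j <= d (and k >= d).
   K[i]^o is K[i] with the topology given by its absolute value. *)
Definition poincare_recurrence (K : realType) (d : nat) (c : nat -> K[i])
    (psi : nat -> nat -> K[i]) (a : nat -> K[i]) : Prop :=
  (forall k : nat, (d <= k)%N ->
     a k = \sum_(1 <= j < d.+1) (c j + psi j k) * a (k - j)%N) /\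
  (forall j : nat, (1 <= j <= d)%N ->
     (psi j : nat -> K[i]^o) @ \oo --> (0 : K[i]^o)).

Definition characteristic_polynomial (K : realType) (d : nat)
    (c : nat -> K[i]) : {poly K[i]} :=
  'X^d - \sum_(1 <= j < d.+1) c j *: 'X^(d - j).

(* sigma lists the roots of p with multiplicity; p is meant to be monic. *)
Definition roots_of (K : realType) (d : nat) (p : {poly K[i]})
    (sigma : d.-tuple K[i]) : Prop :=
  p = \prod_(s <- sigma) ('X - s%:P).

Definition max_modulus (K : realType) (d : nat) (sigma : d.-tuple K[i]) : K :=
  \big[Num.max/0]_(s <- sigma) cmod s.

Definition small_perturbation_after (K : realType) (d : nat)
    (psi : nat -> nat -> K[i]) (rho : K) (n : nat) : Prop :=
  forall k : nat, (n < k)%N -> (d <= k)%N ->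
    forall j : nat, (1 <= j <= d)%N -> cmod (psi j k) <= 2 ^+ d * rho ^+ j.

Definition is_minimal_nat (P : nat -> Prop) (n : nat) : Prop :=
  P n /\ forall m : nat, P m -> (n <= m)%N.

(* Main.v *)
Require Import Defs.
From mathcomp Require Import zify lra ring.

Local Open Scope complex_scope.
Local Open Scope classical_set_scope.
Local Open Scope ring_scope.

(** Vieta's formulas express [c j], up to sign, as the [j]-th elementary
    symmetric function of [d] roots of modulus at most [rho], hence
    [|c j| <= 2 ^ d rho ^ j] ([cmod_recurrence_coef_le]).  Past [Nhat] the
    perturbations obey the same bound, so there
    [|c j + psi j k| <= 2 ^ (d + 1) rho ^ j].  Rescale to
    [b k = |a k| R ^ k] and put [q = R rho = 2 ^ - (d + 3)]: then [b k] is at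
    most a combination of [b (k - 1)], ..., [b (k - d)] with the weights
    [2 ^ (d + 1) q ^ j], whose sum is at most [2 ^ (d + 2) q = 1 / 2]
    ([sum_pow_le_double]).  A nonnegative sequence dominated in this way by
    total weight at most 1 never exceeds the maximum of its initial segment
    ([le_bigmax_of_subaverage]).  This gives domination with constant 1, a
    fortiori with the constant [C >= 1]. *)

Section Modulus.
Variable K : realType.
Implicit Types (x y : K[i]) (s : seq K[i]).

Lemma cmod_ge0 x : 0 <= cmod x.
Proof. by case: x => u v; exact: sqrtr_ge0. Qed.

Lemma cmod0 : cmod (0 : K[i]) = 0.
Proof. exact: Normc.normc0. Qed.

Lemma cmodM x y : cmod (x * y) = cmod x * cmod y.
Proof. exact: Normc.normcM. Qed.

Lemma cmodN x : cmod (- x) = cmod x.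
Proof. exact: normcN. Qed.

Lemma cmodD_le x y : cmod (x + y) <= cmod x + cmod y.
Proof. exact: le_normcD. Qed.

Lemma cmod_sum_le (I : Type) (r : seq I) (P : pred I) (F : I -> K[i]) :
  cmod (\sum_(i <- r | P i) F i) <= \sum_(i <- r | P i) cmod (F i).
Proof.
elim/big_rec2: _ => [|i u v _ le_vu]; first by rewrite cmod0.
exact/(le_trans (cmodD_le _ _))/lerD.
Qed.

(** A crude form of the bound by elementary symmetric functions, with [2 ^ n]
    in place of the binomial coefficient.  The factor [rho ^+ i] on the left
    makes both terms of the [i]-th coefficient of [p * ('X - a)] satisfy the
    same bound, so that each new root merely doubles the constant. *)
Lemma cmod_coef_prod_XsubC_le (rho : K) s (i : nat) :
  0 <= rho -> (forall x, x \in s -> cmod x <= rho) ->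
  cmod (\prod_(x <- s) ('X - x%:P))`_i * rho ^+ i
    <= 2 ^+ size s * rho ^+ size s.
Proof.
move=> rho_ge0; elim: s i => [|x s IHs] i le_s_rho.
  rewrite big_nil coef1 !expr0 mulr1; case: i => [|i].
    by rewrite eqxx expr0 mulr1 [cmod _]Normc.normc1.
  by rewrite cmod0 mul0r ler01.
have le_x_rho : cmod x <= rho by apply: le_s_rho; rewrite mem_head.
have {}IHs j : cmod (\prod_(y <- s) ('X - y%:P))`_j * rho ^+ j
    <= 2 ^+ size s * rho ^+ size s.
  by apply: IHs => y ys; apply: le_s_rho; rewrite inE ys orbT.
rewrite big_cons mulrBl coefB coefXM coefCM /=.
set p := \prod_(y <- s) _ in IHs *.
have shift_le : cmod (if i == 0%N then 0 else p`_i.-1) * rho ^+ i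
    <= rho * (2 ^+ size s * rho ^+ size s).
  case: i => [|j]; last first.
    by rewrite exprS mulrCA; exact: (ler_wpM2l rho_ge0 (IHs j)).
  by rewrite eqxx cmod0 mul0r !mulr_ge0 ?exprn_ge0 ?ler0n.
have scale_le : cmod (x * p`_i) * rho ^+ i
    <= rho * (2 ^+ size s * rho ^+ size s).
  by rewrite cmodM -mulrA ler_pM ?mulr_ge0 ?cmod_ge0 ?exprn_ge0.
have -> : 2 ^+ (size s).+1 * rho ^+ (size s).+1
    = rho * (2 ^+ size s * rho ^+ size s)
      + rho * (2 ^+ size s * rho ^+ size s) by rewrite !exprS; ring.
apply: le_trans (lerD shift_le scale_le).
rewrite -mulrDl ler_wpM2r ?exprn_ge0 //.
by rewrite -[cmod (x * _)]cmodN cmodD_le.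
Qed.

Lemma cmod_le_max_modulus (d : nat) (sigma : d.-tuple K[i]) x :
  x \in tval sigma -> cmod x <= max_modulus sigma.
Proof. by move=> x_sigma; exact: le_bigmax_seq. Qed.

End Modulus.

Lemma coef_characteristic_polynomial (K : realType) (d : nat) (c : nat -> K[i])
    (j : nat) : (1 <= j <= d)%N ->
  (characteristic_polynomial d c)`_(d - j) = - c j.
Proof.
move=> /andP[j_gt0 le_jd].
rewrite /characteristic_polynomial coefB coefXn coef_sum.
have /negbTE -> : (d - j)%N != d by lia.
rewrite sub0r (bigD1_seq j) /= ?iota_uniq ?mem_index_iota ?j_gt0 //.
rewrite coefZ coefXn eqxx mulr1 big_seq_cond big1 ?addr0 // => i.
rewrite mem_index_iota => /andP[/andP[i_gt0 lt_id] ne_ij].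
rewrite coefZ coefXn; have /negbTE -> : (d - j)%N != (d - i)%N by lia.
by rewrite mulr0.
Qed.

Lemma cmod_recurrence_coef_le (K : realType) (d : nat) (c : nat -> K[i])
    (sigma : d.-tuple K[i]) (j : nat) :
  roots_of (characteristic_polynomial d c) sigma -> 0 < max_modulus sigma ->
  (1 <= j <= d)%N -> cmod (c j) <= 2 ^+ d * max_modulus sigma ^+ j.
Proof.
move=> roots_sigma rho_gt0 j_range; have /andP[_ le_jd] := j_range.
rewrite -cmodN -(coef_characteristic_polynomial _ _ c _ j_range) roots_sigma.
rewrite -(ler_pM2r (exprn_gt0 (d - j) rho_gt0)) -mulrA -exprD subnKC //.
have := cmod_coef_prod_XsubC_le _ _ sigma (d - j) (ltW rho_gt0).
by rewrite size_tuple; apply; exact: cmod_le_max_modulus.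
Qed.

Lemma sum_pow_le_double (F : realFieldType) (q : F) (n : nat) :
  0 <= q -> q <= 2^-1 -> \sum_(1 <= j < n.+1) q ^+ j <= 2 * q.
Proof.
move=> q_ge0 q_le; elim: n => [|n IHn].
  by rewrite big_geq // mulr_ge0.
rewrite big_nat_recl // expr1 (eq_bigr (fun j => q * q ^+ j)); last first.
  by move=> j _; rewrite exprS.
rewrite -big_distrr /=; nra.
Qed.

(** Strong induction: each term past [N] is at most a subconvex combination
    of earlier terms, all of which lie below the maximum. *)
Lemma le_bigmax_of_subaverage (F : realFieldType) (d N : nat) (w b : nat -> F) :
  (forall j, 0 <= w j) -> \sum_(1 <= j < d.+1) w j <= 1 ->
  (forall k, (N < k)%N -> b k <= \sum_(1 <= j < d.+1) w j * b (k - j)%N) ->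
  forall k, b k <= \big[Num.max/0]_(0 <= i < N.+1) b i.
Proof.
move=> w_ge0 sum_w rec_b; set M := \big[_/_]_(_ <= _ < _) _.
have M_ge0 : 0 <= M by exact: bigmax_ge_id.
elim/ltn_ind=> k IHk; case: (leqP k N) => [le_kN|lt_Nk].
  by apply: le_bigmax_seq => //; rewrite mem_index_iota.
apply: le_trans (rec_b k lt_Nk) _.
apply: (@le_trans _ _ (\sum_(1 <= j < d.+1) w j * M)).
  apply: ler_sum_nat => j /andP[j_gt0 _].
  by apply: ler_wpM2l => //; apply: IHk; lia.
by rewrite -big_distrl /= -[leRHS]mul1r ler_wpM2r.
Qed.

Theorem theorem5p3 (K : realType) (d : nat) (c : nat -> K[i])
    (psi : nat -> nat -> K[i]) (a : nat -> K[i]) (sigma : d.-tuple K[i])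
    (rho R C : K) (Nhat N : nat) :
  (1 <= d)%N ->
  poincare_recurrence d c psi a ->
  roots_of (characteristic_polynomial d c) sigma ->
  rho = max_modulus sigma ->
  0 < rho ->
  R = 2 ^- (d + 3) * rho^-1 ->
  is_minimal_nat (small_perturbation_after d psi rho) Nhat ->
  N = (Nhat + d)%N ->
  C = 2 ^+ ((d + 3) * N) ->
  taylor_domination N R C a.
Proof.
move=> d_gt0 [rec_a _] roots_sigma rhoE rho_gt0 RE [small_psi _] NE CE k _.
pose q : K := 2 ^- (d + 3).
have q_ge0 : 0 <= q by rewrite invr_ge0 exprn_ge0.
have RrhoE : rho * R = q by rewrite RE mulrCA divff ?mulr1 // gt_eqF.
have R_ge0 : 0 <= R by rewrite RE mulr_ge0 ?invr_ge0 ?exprn_ge0 // ltW.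
(* The total weight: the factor 2 ^ (d + 1) comes from the coefficients, one
   more factor 2 from the geometric sum, against q = 2 ^ - (d + 3). *)
have powE : 2 ^+ d.+1 * (2 * q) = 2^-1.
  rewrite /q addn3 !exprS; field.
  by rewrite expf_neq0 // pnatr_eq0.
have pow_ge1 : 1 <= 2 ^+ d.+1 :> K by rewrite exprn_ege1 // ler1n.
have q_le : q <= 2^-1 by nra.
have C_ge1 : 1 <= C by rewrite CE exprn_ege1 // ler1n.
apply: (@le_trans _ _ (\big[Num.max/0]_(0 <= i < N.+1) (cmod (a i) * R ^+ i))).
  apply: (@le_bigmax_of_subaverage _ d N (fun j => 2 ^+ d.+1 * q ^+ j)
            (fun i => cmod (a i) * R ^+ i)).
  - by move=> j; rewrite mulr_ge0 ?exprn_ge0.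
  - rewrite -big_distrr /=.
    apply: (@le_trans _ _ (2 ^+ d.+1 * (2 * q))).
      by rewrite ler_wpM2l ?exprn_ge0 // sum_pow_le_double.
    by rewrite powE invf_le1 ?ler1n.
  move=> m lt_Nm; have le_dm : (d <= m)%N by lia.
  rewrite (rec_a _ le_dm).
  apply: le_trans (ler_wpM2r (exprn_ge0 _ R_ge0) (cmod_sum_le _ _ _ _ _)) _.
  rewrite big_distrl /=; apply: ler_sum_nat => j /andP[j_gt0 le_jd].
  have j_range : (1 <= j <= d)%N by lia.
  have -> : R ^+ m = R ^+ j * R ^+ (m - j) by rewrite -exprD subnKC //; lia.
  rewrite cmodM -RrhoE exprMn mulrACA.
  rewrite ler_wpM2r ?mulr_ge0 ?cmod_ge0 ?exprn_ge0 //.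
  rewrite mulrA ler_wpM2r ?exprn_ge0 //.
  apply: le_trans (cmodD_le _ _ _) _.
  (* The coefficient and its perturbation each contribute 2 ^ d rho ^ j. *)
  rewrite exprS -mulrA mulrDl mul1r lerD //.
    by rewrite rhoE cmod_recurrence_coef_le // -rhoE.
  by apply: small_psi => //; lia.
by rewrite -[leLHS]mul1r ler_wpM2r // bigmax_ge_id.
Qed.
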